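(* Let $I=[a,b]\subset\mathbb{R}$ with $a\neq b$, let $H\in C^\infty(\mathbb{R}^6,\mathbb{R})$, let $\hat{\mathcal{L}}_H$ be the van Hove-Liouvillian operator $\hat{\mathcal L}_H\chi=i\hbar\{H,\chi\}+\left(H-\tfrac12 z\cdot\nabla H\right)\chi$, and let $\hat{\mathbb{L}}$ be the Koopman-van Hove angular momentum operator $$\hat{\mathbb L}(\chi)(z)=i\hbar\left(\frac{\partial\chi}{\partial p}(z)\times p+\frac{\partial\chi}{\partial q}(z)\times q\right).$$ Let $(\chi_t)_{t\in I}$ be an element of $\mathcal{H}_{vH}$ (a van Hove classical wave function) that solves the van Hove-Liouvillian equation $i\hbar\,\partial_t\chi_t=\hat{\mathcal{L}}_H\chi_t$. Then, for all $t\in I$ and $z=(q,p)\in\mathbb{R}^6$: (i) $$\frac{d}{dt}\hat{\mathbb{L}}(\chi_t)(z)=\frac{\partial}{\partial q}\hat{\mathcal{L}}_H(\chi_t)(z)\times q+\frac{\partial}{\partial p}\hat{\mathcal{L}}_H(\chi_t)(z)\times p=-\frac{i}{\hbar}\left(\hat{\mathbb{L}}\circ\hat{\mathcal{L}}_H\right)(\chi_t)(z);$$ (ii) $$\frac{d}{dt}\langle\hat{\mathbb{L}}\rangle(\chi_t)=\frac{2}{\hbar}\,\mathrm{Im}\left[\langle\hat{\mathbb{L}}(\chi_t)\,|\,\hat{\mathcal{L}}_H(\chi_t)\rangle\right],$$ understood componentwise, i.e. for every $\xi\in\mathbb{R}^3$ the equality holds with $\hat{\mathbb{L}}$ replaced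 by $\hat{\mathbb{L}}_\xi:=\xi\cdot\hat{\mathbb{L}}$ on both sides.
   Context: Phase space is $\mathbb{R}^6$ with points $z=(q,p)$, $q,p\in\mathbb{R}^3$; $\hbar>0$ is a constant. $\partial/\partial q,\partial/\partial p$ are the gradients in $q,p$; $\times$ is the cross product in $\mathbb{R}^3$. The Poisson bracket is $\{F,G\}=\frac{\partial F}{\partial q}\cdot\frac{\partial G}{\partial p}-\frac{\partial F}{\partial p}\cdot\frac{\partial G}{\partial q}$, and $z\cdot\nabla H=q\cdot\frac{\partial H}{\partial q}+p\cdot\frac{\partial H}{\partial p}$. The inner product is $\langle\chi_1|\chi_2\rangle=\int_{\mathbb{R}^6}\chi_1^*(z)\chi_2(z)\,dz$, and for an operator $\hat A$ its average is $\langle\hat A\rangle(\chi):=\langle\chi|\hat A\chi\rangle$ (componentwise for vector-valued operators). $\mathcal{H}_{vH}$, the set of van Hove classical wave functions, consists of the functions $\chi:\mathbb{R}^6\times I\to\mathbb{C}$, $\chi_t:=\chi(\cdot,t)$, such that $\chi_t\in L^2(\mathbb{R}^6)$ for all $t$, $\chi(z,\cdot)$ is smooth for all $z$, $\lim_{|z|\to\infty}\chi_t(z)=0$ for all $t$, and $|\chi_t|^2+\mathrm{div}(\chi_t^*\hat{\mathcal{Z}}\chi_t)=\rho_t$ is a probability density on $\mathbb{R}^6$, where $\hat{\mathcal{Z}}\chi=\frac12 z\chi-i\hbar\,\mathbb{J}\nabla\chi$ and $\mathbb{J}(u,v)=(v,-u)$ for $u,v\in\mathbb{R}^3$. Wave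 functions are taken smooth in $(z,t)$ and decaying sufficiently for all expressions to be defined, for differentiation under the integral sign, and for the operators $\hat{\mathbb{L}}_\xi,\hat{\mathcal{L}}_H$ to act symmetrically with respect to $\langle\cdot|\cdot\rangle$ (they are regarded as Hermitian operators). *)

(* Defs.v *)
From HB Require Import structures.
From mathcomp Require Import all_boot all_order all_algebra.
From mathcomp Require Import complex.
From mathcomp Require Import all_classical all_reals all_analysis.

Set Implicit Arguments.
Unset Strict Implicit.
Unset Printing Implicit Defensive.
Import Order.TTheory GRing.Theory Num.Theory.
Import numFieldNormedType.Exports.

Local Open Scope classical_set_scope.
Local Open Scope ring_scope.

(* Phase space R^6: a point is z = (q, p) with q = z.1 and p = z.2. *)
Notation phase R := ('rV[R]_3 * 'rV[R]_3)%type.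

(** * Smoothness *)

(* In the finite-dimensional spaces used here (R^6, R, R x R^6), f is C^(n+1)
   iff f is continuous and all its directional derivatives exist and are C^n. *)
Fixpoint Cn (R : realType) (V : normedModType R) (n : nat) (f : V -> R^o)
    : Prop :=
  match n with
  | 0 => continuous f
  | m.+1 => continuous f /\
      forall v : V, (forall x, derivable f x v) /\ Cn m (fun x => 'D_v f x)
  end.

Definition smooth (R : realType) (V : normedModType R) (f : V -> R^o) : Prop :=
  forall n, Cn n f.

Definition csmooth (R : realType) (V : normedModType R) (f : V -> R[i])
    : Prop :=
  smooth (fun x => complex.Re (f x)) /\ smooth (fun x => complex.Im (f x)).

(* Smoothness on a set that need not be open (here I and I x R^6 with I a
   compact interval): existence of a smooth extension to the whole space. *)
Definition csmooth_on (R : realType) (V : normedModType R) (A : set V)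
    (f : V -> R[i]) : Prop :=
  exists g : V -> R[i], csmooth g /\ forall x, A x -> f x = g x.

(** * Time derivatives on [a, b], one-sided at the end points *)

Definition is_tderive (R : realType) (a b : R) (f : R -> R) (t l : R) : Prop :=
  (s - t)^-1 * (f s - f t) @[s --> within [set` `[a, b]] t^'] --> l.

Definition is_ctderive (R : realType) (a b : R) (f : R -> R[i]) (t : R)
    (l : R[i]) : Prop :=
  is_tderive a b (fun s => complex.Re (f s)) t (complex.Re l) /\
  is_tderive a b (fun s => complex.Im (f s)) t (complex.Im l).

Definition is_vtderive (R : realType) (a b : R) (n : nat)
    (f : R -> 'rV[R[i]]_n) (t : R) (l : 'rV[R[i]]_n) : Prop :=
  forall k, is_ctderive a b (fun s => f s 0 k) t (l 0 k).

(** * Vector calculus on phase space *)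

(* The derivative of a complex-valued function along the real vector v. *)
Definition pderive (R : realType) (v : phase R) (f : phase R -> R[i])
    (z : phase R) : R[i] :=
  ('D_v (fun y => complex.Re (f y) : R^o) z +i*
   'D_v (fun y => complex.Im (f y) : R^o) z)%C.

Definition dirq (R : realType) (k : 'I_3) : phase R := (delta_mx 0 k, 0).
Definition dirp (R : realType) (k : 'I_3) : phase R := (0, delta_mx 0 k).

Definition gradq (R : realType) (f : phase R -> R[i]) (z : phase R)
    : 'rV[R[i]]_3 := \row_k pderive (dirq R k) f z.
Definition gradp (R : realType) (f : phase R -> R[i]) (z : phase R)
    : 'rV[R[i]]_3 := \row_k pderive (dirp R k) f z.

Definition toC3 (R : realType) (u : 'rV[R]_3) : 'rV[R[i]]_3 :=
  map_mx (fun x => x%:C%C) u.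

Definition dotp (R : realType) (u v : 'rV[R[i]]_3) : R[i] :=
  \sum_k u 0 k * v 0 k.

(* Indices are added modulo 3, in the ring 'I_3 = Z/3Z. *)
Definition crossp (R : realType) (u v : 'rV[R[i]]_3) : 'rV[R[i]]_3 :=
  \row_k (u 0 (k + 1) * v 0 (k + 2%:R) - u 0 (k + 2%:R) * v 0 (k + 1)).

Definition poisson (R : realType) (F G : phase R -> R[i]) (z : phase R)
    : R[i] :=
  dotp (gradq F z) (gradp G z) - dotp (gradp F z) (gradq G z).

Definition sympJ (R : realType) (w : 'rV[R[i]]_3 * 'rV[R[i]]_3)
    : 'rV[R[i]]_3 * 'rV[R[i]]_3 := (w.2, - w.1).

Definition divergence (R : realType)
    (F : phase R -> 'rV[R[i]]_3 * 'rV[R[i]]_3) (z : phase R) : R[i] :=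
  \sum_k (pderive (dirq R k) (fun y => (F y).1 0 k) z +
          pderive (dirp R k) (fun y => (F y).2 0 k) z).

(** * Lebesgue integration over phase space *)

(* Real 6-tuples with the product sigma-algebra, as 'rV[R]_3 carries none. *)
Notation coord6 R :=
  (measurableTypeR R * measurableTypeR R * measurableTypeR R *
   measurableTypeR R * measurableTypeR R * measurableTypeR R)%type.

Definition leb6 (R : realType) : {measure set (coord6 R) -> \bar R} :=
  (lebesgue_measure \x lebesgue_measure \x lebesgue_measure \x
   lebesgue_measure \x lebesgue_measure \x lebesgue_measure)%E.

Definition point (R : realType) (w : coord6 R) : phase R :=
  let: (q1, q2, q3, p1, p2, p3) := w in
  (\row_k tnth [tuple q1; q2; q3] k, \row_k tnth [tuple p1; p2; p3] k).

Definition integrable6 (R : realType) (f : phase R -> R) : Prop :=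
  (leb6 R).-integrable setT (fun w => (f (point w))%:E).

Definition integral6 (R : realType) (f : phase R -> R) : R :=
  Rintegral (leb6 R) setT (fun w => f (point w)).

Definition cintegrable6 (R : realType) (f : phase R -> R[i]) : Prop :=
  integrable6 (fun z => complex.Re (f z)) /\
  integrable6 (fun z => complex.Im (f z)).

Definition cintegral6 (R : realType) (f : phase R -> R[i]) : R[i] :=
  (integral6 (fun z => complex.Re (f z)) +i*
   integral6 (fun z => complex.Im (f z)))%C.

Definition square_integrable (R : realType) (f : phase R -> R[i]) : Prop :=
  [/\ measurable_fun setT (fun w => complex.Re (f (point w))),
      measurable_fun setT (fun w => complex.Im (f (point w))) &
      integrable6 (fun z => complex.Re (f z) ^+ 2 + complex.Im (f z) ^+ 2)].

Definition inner (R : realType) (f g : phase R -> R[i]) : R[i] :=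
  cintegral6 (fun z => conjc (f z) * g z).

Definition average (R : realType)
    (A : (phase R -> R[i]) -> phase R -> R[i]) (f : phase R -> R[i]) : R[i] :=
  inner f (A f).

Definition probability_density (R : realType) (rho : phase R -> R) : Prop :=
  [/\ forall z, 0 <= rho z, integrable6 rho & integral6 rho = 1].

(** * Operators on wave functions *)

Definition ihbar (R : realType) (hbar : R) : R[i] := ('i * hbar%:C)%C.

Definition liouvillian (R : realType) (hbar : R) (H : phase R -> R)
    (f : phase R -> R[i]) (z : phase R) : R[i] :=
  let HC := fun y => (H y)%:C%C in
  ihbar hbar * poisson HC f z +
  (HC z - 2^-1 * (dotp (toC3 z.1) (gradq HC z) +
                  dotp (toC3 z.2) (gradp HC z))) * f z.

Definition ang_mom (R : realType) (hbar : R) (f : phase R -> R[i])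
    (z : phase R) : 'rV[R[i]]_3 :=
  ihbar hbar *:
    (crossp (gradp f z) (toC3 z.2) + crossp (gradq f z) (toC3 z.1)).

Definition ang_mom_along (R : realType) (hbar : R) (xi : 'rV[R]_3)
    (f : phase R -> R[i]) (z : phase R) : R[i] :=
  dotp (toC3 xi) (ang_mom hbar f z).

Definition Zop (R : realType) (hbar : R) (f : phase R -> R[i]) (z : phase R)
    : 'rV[R[i]]_3 * 'rV[R[i]]_3 :=
  (2^-1 * f z) *: (toC3 z.1, toC3 z.2) -
  ihbar hbar *: sympJ (gradq f z, gradp f z).

(** * Van Hove wave functions *)

(* The expression is complex-valued: that it equals rho z for a real density
   rho includes the claim that it is real. *)
Definition has_vanHove_density (R : realType) (hbar : R)
    (f : phase R -> R[i]) : Prop :=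
  exists2 rho : phase R -> R, probability_density rho &
    forall z, conjc (f z) * f z +
              divergence (fun y => conjc (f y) *: Zop hbar f y) z
              = (rho z)%:C%C.

(* Only the values chi t with t in [a, b] are meaningful. *)
Record vanHove_wave_function (R : realType) (hbar a b : R)
    (chi : R -> phase R -> R[i]) : Prop := {
  vH_L2 : forall t, t \in `[a, b] -> square_integrable (chi t);
  vH_smooth : forall z,
    csmooth_on ([set` `[a, b]] : set R^o) (fun t : R^o => chi t z);
  vH_vanish : forall t, t \in `[a, b] ->
    forall e : R, 0 < e -> exists M : R,
      forall z, M < `|z| -> `|chi t z| < e%:C%C;
  vH_density : forall t, t \in `[a, b] -> has_vanHove_density hbar (chi t)
}.

Definition acts_symmetrically (R : realType)
    (A : (phase R -> R[i]) -> phase R -> R[i]) (f g : phase R -> R[i])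
    : Prop :=
  [/\ cintegrable6 (fun z => conjc (f z) * A g z),
      cintegrable6 (fun z => conjc (A f z) * g z) &
      inner f (A g) = inner (A f) g].

(* The standing conventions on wave functions: joint smoothness; enough decay
   for all averages to exist (integrability is part of [acts_symmetrically])
   and for differentiating <chi_t | L_xi chi_t> under the integral sign (an
   integrable majorant of the time derivative of the integrand); symmetry of
   L_H on chi_t, and of L_xi on chi_t and against L_H chi_t, the latter being
   i hbar d/dt chi_t along a solution. *)
Record regular_wave_function (R : realType) (hbar a b : R)
    (H : phase R -> R) (chi : R -> phase R -> R[i]) : Prop := {
  reg_smooth :
    csmooth_on [set x : (R^o * phase R)%type | x.1 \in `[a, b]]
      (fun x => chi x.1 x.2);
  reg_dominated : forall xi : 'rV[R]_3,
    exists2 g : phase R -> R, integrable6 g &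
      forall t z d, t \in `[a, b] ->
        is_ctderive a b
          (fun s => conjc (chi s z) * ang_mom_along hbar xi (chi s) z) t d ->
        `|d| <= (g z)%:C%C;
  reg_sym_ang_mom : forall (xi : 'rV[R]_3) t, t \in `[a, b] ->
    acts_symmetrically (ang_mom_along hbar xi) (chi t) (chi t) /\
    acts_symmetrically (ang_mom_along hbar xi) (chi t)
      (liouvillian hbar H (chi t));
  reg_sym_liouvillian : forall t, t \in `[a, b] ->
    acts_symmetrically (liouvillian hbar H) (chi t) (chi t)
}.

Definition solves_vanHove (R : realType) (hbar a b : R) (H : phase R -> R)
    (chi : R -> phase R -> R[i]) : Prop :=
  forall t z, t \in `[a, b] ->
    exists2 d : R[i], is_ctderive a b (fun s => chi s z) t d &
      ihbar hbar * d = liouvillian hbar H (chi t) z.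

(* Main.v *)
(* Along a solution, [d/dt chi = (i hbar)^-1 L_H chi]. For a function that is
   jointly smooth in (t, z), the time derivative commutes with the phase-space
   derivatives, so [d/dt L chi = L ((i hbar)^-1 L_H chi)], which is (i).
   Differentiating [<chi | L_xi chi>] under the integral sign and using the
   symmetry of L_xi between [chi] and [L_H chi] gives
   [(i hbar)^-1 (K - conj K)] with [K = <L_xi chi | L_H chi>], which is
   [(2 / hbar) Im K]. *)

Require Import Defs.
From mathcomp Require Import all_boot all_order all_algebra.
From mathcomp Require Import complex ring lra.
From mathcomp Require Import all_classical all_reals all_analysis.
From mathcomp Require Import measurable_realfun.
Set Implicit Arguments.
Unset Strict Implicit.
Unset Printing Implicit Defensive.
Import Order.TTheory GRing.Theory Num.Theory.
Import numFieldNormedType.Exports.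
Local Open Scope classical_set_scope.
Local Open Scope ring_scope.

(** * Symmetry of second directional derivatives *)

Section DirectionalDerivatives.
Context {R : realType} {V : normedModType R}.
Implicit Types (f : V -> R^o) (x u v : V).

Lemma derivable_shift f x u v :
  derivable f (x + v) u -> derivable (fun y => f (y + v)) x u.
Proof.
rewrite /derivable /=; under eq_fun do rewrite addrA; exact.
Qed.

Lemma derive_shift f x u v : 'D_u (fun y => f (y + v)) x = 'D_u f (x + v).
Proof.
by rewrite /derive /=; under eq_fun do rewrite -addrA.
Qed.

Lemma is_derive_line f x v (s : R) : derivable f (x + s *: v) v ->
  is_derive s 1 (fun r : R => f (x + r *: v) : R^o) ('D_v f (x + s *: v)).
Proof.
have E : (fun h : R => h^-1 *: (((fun r : R => f (x + r *: v) : R^o) \o shift s)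
            (h *: (1 : R^o)) - f (x + s *: v))) =
         (fun h : R => h^-1 *: ((f \o shift (x + s *: v)) (h *: v)
            - f (x + s *: v))).
  apply/funext => h /=; congr (_ *: (f _ - _)).
  by rewrite [h *: 1]mulr1 scalerDl addrCA.
move=> df; apply: DeriveDef; rewrite /derivable /derive E //.
Qed.

Lemma mean_value_line f x v (h : R) : 0 < h -> (forall y, derivable f y v) ->
  exists2 c : R, 0 < c < h & f (x + h *: v) - f x = h * 'D_v f (x + c *: v).
Proof.
move=> h0 df.
have dl s := @is_derive_line f x v s (df _).
have [|c] := MVT h0 (fun s _ => dl s).
  by apply: derivable_within_continuous => s _; case: (dl s).
rewrite in_itv /= => ch; rewrite scale0r addr0 subr0 => ->.
by exists c => //; rewrite mulrC.
Qed.

(** The mean value theorem along [u], applied to the increment [f (y + h *: v) - f y], yields an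
    increment of ['D_u f] along [v], to which it applies a second time. *)
Lemma second_difference f x u v (h : R) : 0 < h ->
  (forall y, derivable f y u) -> (forall y, derivable ('D_u f) y v) ->
  exists2 cd : R * R, (0 < cd.1 < h) && (0 < cd.2 < h) &
    f (x + h *: u + h *: v) - f (x + h *: u) - (f (x + h *: v) - f x) =
    h * (h * 'D_v ('D_u f) (x + cd.1 *: u + cd.2 *: v)).
Proof.
move=> h0 df ddf.
have dsh y : derivable (fun y => f (y + h *: v)) y u by exact: derivable_shift.
have [y|c ch] :=
  @mean_value_line (fun y => f (y + h *: v) - f y : R^o) x u h h0.
  exact: derivableB.
rewrite deriveB // derive_shift => E.
have [d dh E'] := @mean_value_line ('D_u f) (x + c *: u) v h h0 ddf.
by exists (c, d); rewrite /= ?ch ?dh // -E' -E.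
Qed.

(* Both mixed derivatives are limits of the same second difference quotient. *)
Lemma derive_comm f x u v : Cn 2 f -> 'D_u ('D_v f) x = 'D_v ('D_u f) x.
Proof.
move=> [_ C1].
have d1 w y : derivable f y w by case: (C1 w).
have d2 w w' y : derivable ('D_w f) y w'.
  by case: (C1 w) => _ [_ /(_ w')[]].
have c2 w w' : continuous ('D_w' ('D_w f)).
  by case: (C1 w) => _ [_ /(_ w')[_]].
apply/eqP; rewrite -subr_eq0 -normr_le0; apply/ler_addgt0Pr => e e0.
rewrite add0r.
have e20 : 0 < e / 2 by rewrite divr_gt0.
have /cvgrPdist_le /(_ _ e20) /nbhs_ballP[r1 /= r10 H1] := c2 v u x.
have /cvgrPdist_le /(_ _ e20) /nbhs_ballP[r2 /= r20 H2] := c2 u v x.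
pose r := Num.min r1 r2.
have r0 : 0 < r by rewrite lt_min r10.
have m0 : 0 < `|u| + `|v| + 1 by rewrite ltr_wpDl // addr_ge0.
(* Steps shorter than [h] along [u] and along [v] add up to a displacement shorter than [r]; the
   [+ 1] guards against [u = v = 0]. *)
pose h := r / (`|u| + `|v| + 1).
have h0 : 0 < h by rewrite divr_gt0.
have near_x (c d : R) w w' : 0 < c < h -> 0 < d < h ->
    `|w| + `|w'| = `|u| + `|v| ->
    ball x r (x + c *: w + d *: w').
  move=> /andP[c0 ch] /andP[d0 dh] ww'; rewrite -ball_normE /ball_ /=.
  rewrite -addrA opprD addNKr normrN (le_lt_trans (ler_normD _ _)) //.
  rewrite !normrZ !gtr0_norm //.
  apply: (@le_lt_trans _ _ (h * (`|u| + `|v|))).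
    by rewrite -ww' mulrDr lerD // ler_wpM2r // ltW.
  by rewrite /h mulrAC ltr_pdivrMr // ltr_pM2l // ltrDl.
have [[c d] /= /andP[ch dh] E1] := @second_difference f x u v h h0 (d1 u) (d2 u v).
have [[c' d'] /= /andP[ch' dh'] E2] :=
  @second_difference f x v u h h0 (d1 v) (d2 v u).
(* The second difference is symmetric in [u] and [v], so both mixed derivatives express the same
   number; the factor [h] cancels twice. *)
have E : 'D_v ('D_u f) (x + c *: u + d *: v) =
         'D_u ('D_v f) (x + c' *: v + d' *: u).
  apply: (mulfI (lt0r_neq0 h0)); apply: (mulfI (lt0r_neq0 h0)).
  apply: etrans (esym E1) _; apply: etrans E2.
  rewrite (addrAC x).
  move: (f _) (f _) (f _) (f _) => p q w s.
  by rewrite !opprB addrACA [RHS]addrACA (addrC (- q)).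
have B1 := near_x c' d' v u ch' dh' (addrC _ _).
have B2 := near_x c d u v ch dh erefl.
have rr1 : r <= r1 by rewrite ge_min lexx.
have rr2 : r <= r2 by rewrite ge_min lexx orbT.
have := H1 _ (le_ball rr1 B1); rewrite /= => N1.
have := H2 _ (le_ball rr2 B2); rewrite /= => N2.
move: N1 N2; rewrite E.
move=> N1 N2; apply: le_trans (ler_distD _ _ _) _; rewrite [leRHS]splitr.
by apply: lerD; [exact: N1|rewrite distrC; exact: N2].
Qed.

End DirectionalDerivatives.

(** * Partial derivatives on the product of the time line and a normed space *)

Section Slices.
Context {R : realType} {V : normedModType R}.
Implicit Types (g : (R^o * V)%type -> R^o) (t : R) (z v : V).

(** The direction [(0, v)] keeps the time coordinate at [h *: 0 + t], which is [t]. Derivability and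
    derivatives of a slice thus transfer by rewriting, without a chain rule. *)
Lemma slice_quotient g t z v :
  (fun h : R => h^-1 *: (((fun y => g (t, y)) \o shift z) (h *: v) - g (t, z))) =
  (fun h : R => h^-1 *: ((g \o shift ((t, z) : R^o * V))
                 (h *: ((0, v) : R^o * V)) - g (t, z))).
Proof.
apply/funext => h; congr (_ *: (g _ - _)).
have E : t = h *: (0 : R^o) + t by rewrite scaler0 add0r.
exact: (congr1 (fun r : R^o => (r, h *: v + z)) E).
Qed.

Lemma derivable_slice g t z v :
  derivable (fun y => g (t, y)) z v = derivable g (t, z) (0, v).
Proof. by rewrite /derivable slice_quotient. Qed.

Lemma derive_slice g t z v :
  'D_v (fun y => g (t, y)) z = 'D_((0, v) : R^o * V) g (t, z).
Proof. by rewrite /derive slice_quotient. Qed.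

Lemma is_derive_time_slice g t z : derivable g (t, z) (1, 0) ->
  is_derive t 1 (fun s : R => g (s, z) : R^o)
    ('D_((1, 0) : R^o * V) g (t, z)).
Proof.
have E : (fun h : R => h^-1 *: (((fun s : R => g (s, z) : R^o) \o shift t)
            (h *: (1 : R^o)) - g (t, z))) =
         (fun h : R => h^-1 *: ((g \o shift ((t, z) : R^o * V))
            (h *: ((1, 0) : R^o * V)) - g (t, z))).
  apply/funext => h; congr (_ *: (g _ - _)).
  have E : z = h *: (0 : V) + z by rewrite scaler0 add0r.
  exact: (congr1 (fun y : V => (h *: (1 : R^o) + t, y)) E).
move=> df; apply: DeriveDef; rewrite /derivable /derive E //.
Qed.

End Slices.

(** * Calculus of time derivatives on a compact interval *)

Section TimeDerivative.
Context {R : realType} (a b : R).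
Implicit Types (f g : R -> R) (s t : R).

#[local] Instance time_filter t : Filter (within [set` `[a, b]] t^').
Proof. exact: within_filter. Qed.

(** As [a < b], every punctured neighbourhood of [t] meets the interval, also at the end points;
    this makes time derivatives unique. *)
Lemma time_filter_proper t : a < b -> t \in `[a, b] ->
  ProperFilter (within [set` `[a, b]] t^').
Proof.
rewrite in_itv /= => ab /andP[at_ tb]; apply: Build_ProperFilter_ex => P.
rewrite /within /= /dnbhs /= => /nbhs_ballP[e /= e0 He].
(* The first bound keeps the new point in the ball; the second lets a step towards the farther end
   point stay in the interval. *)
pose e' := Num.min (e / 2) ((b - a) / 2).
have e'0 : 0 < e' by rewrite lt_min !divr_gt0 // subr_gt0.
have e'e : e' < e by rewrite gt_min ltr_pdivrMr // ltr_pMr // ltr1n.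
have e'ba : e' <= (b - a) / 2 by rewrite ge_min lexx orbT.
have [tm|mt] := leP t ((a + b) / 2).
  exists (t + e'); apply: He => /=.
  - by rewrite -ball_normE /ball_ /= opprD addNKr normrN gtr0_norm.
  - by rewrite -subr_eq0 addrAC subrr add0r gt_eqF.
  - by rewrite in_itv /=; apply/andP; split; lra.
exists (t - e'); apply: He => /=.
- by rewrite -ball_normE /ball_ /= opprB addrC subrK gtr0_norm.
- by rewrite -subr_eq0 addrAC subrr add0r oppr_eq0 gt_eqF.
- by rewrite in_itv /=; apply/andP; split; lra.
Qed.

Lemma near_time t (P : set R) : (forall s, s \in `[a, b] -> P s) ->
  \forall s \near within [set` `[a, b]] t^', P s.
Proof. by move=> HP; rewrite near_withinE; near=> s => /= /HP.
Unshelve. all: by end_near. Qed.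

Lemma near_time_neq t :
  \forall s \near within [set` `[a, b]] t^', s != t.
Proof.
rewrite near_withinE; apply: filterS (nbhs_dnbhs_neq t) => s st _; exact: st.
Qed.

Lemma is_tderive_unique f t l l' : a < b -> t \in `[a, b] ->
  is_tderive a b f t l -> is_tderive a b f t l' -> l = l'.
Proof.
move=> ab tab; have FF := time_filter_proper ab tab.
exact: cvg_unique.
Qed.

Lemma is_tderive_eq f g t l : t \in `[a, b] ->
  (forall s, s \in `[a, b] -> f s = g s) ->
  is_tderive a b f t l -> is_tderive a b g t l.
Proof.
move=> tab fg; apply: cvg_trans; apply: near_eq_cvg.
by apply: near_time => s sab; rewrite !fg.
Qed.

(** The increment of [f] is [s - t] times a convergent quotient, hence tends to 0. *)
Lemma is_tderive_cvg f t l : is_tderive a b f t l ->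
  f s @[s --> within [set` `[a, b]] t^'] --> f t.
Proof.
move=> df.
have ct : s @[s --> within [set` `[a, b]] t^'] --> t.
  by apply: cvg_within_filter; exact: nbhs_dnbhs.
have : (s - t) * ((s - t)^-1 * (f s - f t)) + f t
    @[s --> within [set` `[a, b]] t^'] --> (t - t) * l + f t.
  apply: cvgD; last exact: cvg_cst.
  by apply: cvgM => //; apply: cvgB => //; exact: cvg_cst.
rewrite subrr mul0r add0r; apply: cvg_trans; apply: near_eq_cvg.
near=> s.
rewrite mulrA mulfV ?mul1r ?subrK // subr_eq0.
by near: s; exact: near_time_neq.
Unshelve. all: by end_near. Qed.

Lemma is_tderive_cst (c t : R) : is_tderive a b (cst c) t 0.
Proof.
rewrite /is_tderive; under eq_fun do rewrite subrr mulr0.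
exact: cvg_cst.
Qed.

Lemma is_tderiveD f g t l m : is_tderive a b f t l -> is_tderive a b g t m ->
  is_tderive a b (fun s => f s + g s) t (l + m).
Proof.
move=> df dg; apply: cvg_trans (cvgD df dg); apply: near_eq_cvg.
by near=> s; rewrite /= -mulrDr opprD addrACA.
Unshelve. all: by end_near. Qed.

Lemma is_tderiveN f t l : is_tderive a b f t l ->
  is_tderive a b (fun s => - f s) t (- l).
Proof.
move=> df; apply: cvg_trans (cvgN df); apply: near_eq_cvg.
by near=> s; rewrite /= -mulrN opprD.
Unshelve. all: by end_near. Qed.

Lemma is_tderiveM f g t l m : is_tderive a b f t l -> is_tderive a b g t m ->
  is_tderive a b (fun s => f s * g s) t (l * g t + f t * m).
Proof.
move=> df dg.
(* The increment of the product is split as [(f s - f t) * g s + f t * (g s - g t)]; the first term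
   calls for continuity of [g] at [t]. *)
apply: cvg_trans (cvgD (cvgM df (is_tderive_cvg dg)) (cvgM (cvg_cst (f t)) dg)).
apply: near_eq_cvg.
by near=> s; rewrite !fctE /=; ring.
Unshelve. all: by end_near. Qed.

(** Passes from the quotient in an increment near 0 to the quotient in [s] near [t]; the change of
    variable is made on sequences. *)
Lemma is_derive_is_tderive f t l : is_derive t 1 f l ->
  is_tderive a b f t l.
Proof.
move=> [df dl]; apply: cvg_within_filter.
move: df; rewrite /derivable => /cvg_ex[l' fl'].
have E : l = l' by rewrite -dl; apply/cvg_lim.
rewrite E; apply/cvgr_dnbhsP => u [ut uc].
pose F (h : R) : R := h^-1 * (f (h * 1 + t) - f t).
rewrite [X in X @ _ --> _](_ : _ = fun n => F (u n - t)); last first.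
  by apply/funext => n; rewrite /F mulr1 subrK.
move/(@cvgr_dnbhsP _ F 0 l'): fl'; apply; split => [n|].
  by rewrite subr_eq0.
by rewrite -(subrr t); apply: cvgB => //; exact: cvg_cst.
Qed.

End TimeDerivative.

(** * Mean value inequality for time derivatives *)

Section MeanValueInequality.
Context {R : realType} (a b : R).
Implicit Types (f : R -> R) (s t : R).

(** The closed interval is a neighbourhood of an interior point, so restricting the limit to it
    changes nothing. *)
Lemma is_tderive_interior f t l : t \in `]a, b[ ->
  is_tderive a b f t l -> is_derive t 1 f l.
Proof.
move=> tab df.
have dft : (s - t)^-1 * (f s - f t) @[s --> t^'] --> l.
  move=> P /df; rewrite /nbhs /= /within /= => HP.
  have : \forall s \near t^', s \in `[a, b].
    apply: nbhs_dnbhs; near=> s; apply: subset_itv_oo_cc.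
    by near: s; exact: near_in_itvoo.
  by move=> Hs; apply: filterS2 HP Hs => s; exact.
have dl : h^-1 *: ((f \o shift t) (h *: 1) - f t) @[h --> 0^'] --> l.
  apply/cvgr_dnbhsP => u [u0 uc].
  pose F s : R := (s - t)^-1 * (f s - f t).
  rewrite [X in X @ _ --> _](_ : _ = fun n => F (u n + t)); last first.
    by apply/funext => n; rewrite /F /= addrK [u n *: 1]mulr1.
  move/(@cvgr_dnbhsP _ F t l): dft; apply; split => [n|].
    by rewrite -subr_eq0 addrK.
  by rewrite -[X in _ --> X]add0r; apply: cvgD => //; exact: cvg_cst.
by apply: DeriveDef; [apply/cvg_ex; exists l|exact/cvg_lim].
Unshelve. all: by end_near. Qed.

Lemma is_tderive_continuous f :
  (forall s, s \in `[a, b] -> exists l, is_tderive a b f s l) ->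
  {within `[a, b], continuous f}.
Proof.
move=> df; apply/subspace_continuousP => t /= tab.
have [l /is_tderive_cvg /cvgrPdist_lt ct] := df _ tab.
apply/cvgrPdist_lt => e e0; have := ct _ e0; rewrite !near_withinE /= => H.
have {}H : \forall s \near t, s != t -> s \in `[a, b] -> `|f t - f s| < e.
  exact: H.
apply: filterS H => s H sab; have [->|/H] := eqVneq s t; last exact.
by rewrite subrr normr0.
Qed.

(** Supplies the bound on difference quotients for dominated convergence. The mean value theorem
    takes derivatives only inside []t, s[], where time derivatives are ordinary ones; continuity
    suffices at the ends. *)
Lemma is_tderive_lipschitz f C s t :
  (forall r, r \in `[a, b] -> exists2 l, is_tderive a b f r l & `|l| <= C) ->
  s \in `[a, b] -> t \in `[a, b] -> `|f s - f t| <= C * `|s - t|.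
Proof.
move=> df.
wlog ts : s t / t < s => [wl sab tab|sab tab].
  have [st|st|->] := ltgtP s t; last by rewrite !subrr normr0 mulr0.
    by rewrite distrC (distrC s) wl.
  exact: wl.
have cf : {within `[t, s], continuous f}.
  apply: continuous_subspaceW (is_tderive_continuous _); last first.
    by move=> r /df[l dl _]; exists l.
  by apply: subset_itvScc; rewrite bnd_simp; move: sab tab; rewrite !in_itv /=;
    do 2 case/andP => ? ?.
have sub r : r \in `]t, s[ -> r \in `]a, b[.
  move: sab tab; rewrite !in_itv /= => /andP[_ sb] /andP[ta _] /andP[tr rs].
  by rewrite (le_lt_trans ta tr) (lt_le_trans rs sb).
have dr r : r \in `]t, s[ -> is_derive r 1 f ('D_1 f r).
  move=> /sub rab; have [l dl _] := df _ (subset_itv_oo_cc rab).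
  by have [? ?] := is_tderive_interior rab dl; split.
have [c cts ->] := MVT ts dr cf.
rewrite normrM ler_wpM2r //.
have [l dl lC] := df _ (subset_itv_oo_cc (sub _ cts)).
by have [_ ->] := is_tderive_interior (sub _ cts) dl.
Qed.

End MeanValueInequality.

(** * Differentiation under the integral sign *)

Section DifferentiationUnderIntegral.
Context d {T : measurableType d} {R : realType} (mu : {measure set T -> \bar R}).
Context (a b : R).

(** Dominated convergence is a statement about sequences. If the limit failed, choosing a bad point
    within [n.+1%:R^-1] of [t] for each [n] would give a sequence contradicting the hypothesis. *)
Lemma is_tderive_seq (f : R -> R) t l :
  (forall u : R^nat, (forall n, u n \in `[a, b]) -> (forall n, u n != t) ->
    u n @[n --> \oo] --> t ->
    (u n - t)^-1 * (f (u n) - f t) @[n --> \oo] --> l) ->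
  is_tderive a b f t l.
Proof.
move=> H; apply/cvgrPdist_lt => e e0; apply: contrapT => nH.
have bad n : exists s : R, [/\ s \in `[a, b], s != t, `|t - s| < n.+1%:R^-1 &
    ~ `|l - (s - t)^-1 * (f s - f t)| < e].
  apply: contrapT => /forallNP K; apply: nH.
  rewrite near_withinE /dnbhs near_withinE.
  have n0 : 0 < n.+1%:R^-1 :> R by rewrite invr_gt0.
  have : \forall s \near t, `|t - s| < n.+1%:R^-1.
    by apply/nbhs_ballP; exists (n.+1%:R^-1) => //= s; rewrite -ball_normE.
  apply: filterS => s ts st sab; apply: contrapT => nb; exact: (K s).
have [u Hu] := choice bad.
have uc : u n @[n --> \oo] --> t.
  apply/cvgrPdist_lt => r r0; near=> n; have [_ _ un _] := Hu n.
  apply: lt_trans un _; near: n; exact: near_infty_natSinv_lt (PosNum r0).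
have uab n : u n \in `[a, b] by case: (Hu n).
have ut n : u n != t by case: (Hu n).
have /cvgrPdist_lt /(_ _ e0) [n _ /(_ n (leqnn n)) ?] := H u uab ut uc.
by case: (Hu n).
Unshelve. all: by end_near. Qed.

Lemma is_tderive_cvg_seq (f : R -> R) t l (u : R^nat) : is_tderive a b f t l ->
  (forall n, u n \in `[a, b]) -> (forall n, u n != t) ->
  u n @[n --> \oo] --> t ->
  (u n - t)^-1 * (f (u n) - f t) @[n --> \oo] --> l.
Proof.
move=> df uab ut uc P /df; rewrite /nbhs /= /within /= /dnbhs /within /=.
move=> /uc; rewrite /nbhs /=; apply: filterS => n; exact.
Qed.

(** Dominated convergence for the difference quotients along an arbitrary sequence. The bound by [g]
    is required at all times because the mean value inequality turns it into a bound on these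
    quotients. *)
Lemma is_tderive_Rintegral (f : R -> T -> R) (f' g : T -> R) t :
  t \in `[a, b] ->
  (forall s, s \in `[a, b] -> mu.-integrable setT (EFin \o f s)) ->
  mu.-integrable setT (EFin \o g) ->
  (forall s x, s \in `[a, b] ->
    exists2 l, is_tderive a b (f^~ x) s l & `|l| <= g x) ->
  (forall x, is_tderive a b (f^~ x) t (f' x)) ->
  is_tderive a b (fun s => Rintegral mu setT (f s)) t (Rintegral mu setT f').
Proof.
move=> tab fi gi dom df'; apply: is_tderive_seq => u uab ut uc.
pose q n x := (u n - t)^-1 * (f (u n) x - f t x).
have qi n : mu.-integrable setT (EFin \o q n).
  rewrite (_ : EFin \o q n =
    fun x => ((u n - t)^-1%:E * ((f (u n) x)%:E - (f t x)%:E))%E).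
    by apply: integrableZl => //; apply: integrableB => //; exact: fi.
  by apply/funext => x; rewrite /q /= EFinM EFinB.
have mq n : measurable_fun setT (EFin \o q n) by case/integrableP: (qi n).
have qc x : (q n x)%:E @[n --> \oo] --> (f' x)%:E.
  by apply: cvg_EFin; [exact: nearW|exact: (is_tderive_cvg_seq (df' x) uab ut uc)].
(* Measurability of [f'] comes from its being the pointwise limit of the quotients. *)
have mf' : measurable_fun setT (EFin \o f').
  by apply: (emeasurable_fun_cvg _ _ mq) => x _; exact: qc.
have qg x n : (`|(q n x)%:E| <= (g x)%:E)%E.
  rewrite lee_fin /q normrM normfV mulrC ler_pdivrMr ?normr_gt0 ?subr_eq0 //.
  apply: (@is_tderive_lipschitz _ a b (f^~ x) (g x) (u n) t) => // r rab.
  exact: dom.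
have [f'i _ ] := @dominated_convergence _ _ _ mu setT measurableT
  (fun n x => (q n x)%:E) (EFin \o f') (EFin \o g) mq mf'
  (aeW _ (fun x _ => qc x)) gi (aeW _ (fun x n _ => qg x n)).
rewrite /= => /= C.
rewrite [X in X @ _ --> _](_ : _ = fun n => Rintegral mu setT (q n)); last first.
  apply/funext => n; rewrite /q RintegralZl //; last first.
    rewrite (_ : EFin \o _ = fun x => ((f (u n) x)%:E - (f t x)%:E)%E).
      by apply: integrableB => //; exact: fi.
    by apply/funext => x; rewrite /= EFinB.
  by rewrite RintegralB //; exact: fi.
apply: fine_cvg; rewrite fineK; last exact: integrable_fin_num.
exact: C.
Qed.

End DifferentiationUnderIntegral.

(** * Time derivatives of complex scalars and vectors *)

Section ComplexTimeDerivative.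
Context {R : realType} (a b : R).

Lemma Re_mul (x y : R[i]) : complex.Re (x * y) =
  complex.Re x * complex.Re y + - (complex.Im x * complex.Im y).
Proof. by case: x y => ? ? []. Qed.

Lemma Im_mul (x y : R[i]) : complex.Im (x * y) =
  complex.Re x * complex.Im y + complex.Im x * complex.Re y.
Proof. by case: x y => ? ? []. Qed.

Lemma Re_add (x y : R[i]) : complex.Re (x + y) = complex.Re x + complex.Re y.
Proof. by case: x y => ? ? []. Qed.

Lemma Im_add (x y : R[i]) : complex.Im (x + y) = complex.Im x + complex.Im y.
Proof. by case: x y => ? ? []. Qed.

Lemma Re_conj (x : R[i]) : complex.Re (conjc x) = complex.Re x.
Proof. by case: x. Qed.

Lemma Im_conj (x : R[i]) : complex.Im (conjc x) = - complex.Im x.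
Proof. by case: x. Qed.

Implicit Types (f g : R -> R[i]) (t : R) (l m c : R[i]).

Lemma is_ctderive_cst c t : is_ctderive a b (fun=> c) t 0.
Proof. by split; exact: is_tderive_cst. Qed.

Lemma is_ctderiveD f g t l m : is_ctderive a b f t l -> is_ctderive a b g t m ->
  is_ctderive a b (fun s => f s + g s) t (l + m).
Proof.
move=> [fR fI] [gR gI]; split; rewrite ?Re_add ?Im_add.
  by under eq_fun do rewrite Re_add; exact: is_tderiveD.
by under eq_fun do rewrite Im_add; exact: is_tderiveD.
Qed.

Lemma is_ctderiveM f g t l m : is_ctderive a b f t l -> is_ctderive a b g t m ->
  is_ctderive a b (fun s => f s * g s) t (l * g t + f t * m).
Proof.
move=> [fR fI] [gR gI]; split; rewrite ?Re_add ?Im_add ?Re_mul ?Im_mul.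
  under eq_fun do rewrite Re_mul.
  (* Regroups the real part as the product rule for the real parts minus the product rule for the
     imaginary parts. *)
  rewrite addrACA -opprD.
  by apply: is_tderiveD; [|apply: is_tderiveN]; exact: is_tderiveM.
under eq_fun do rewrite Im_mul.
by rewrite addrACA; apply: is_tderiveD; exact: is_tderiveM.
Qed.

Lemma is_ctderiveZ c f t l : is_ctderive a b f t l ->
  is_ctderive a b (fun s => c * f s) t (c * l).
Proof.
by move=> df; have := is_ctderiveM (is_ctderive_cst c t) df; rewrite mul0r add0r.
Qed.

Lemma is_ctderive_conj f t l : is_ctderive a b f t l ->
  is_ctderive a b (fun s => conjc (f s)) t (conjc l).
Proof.
move=> [fR fI]; split; rewrite ?Re_conj ?Im_conj.
  by under eq_fun do rewrite Re_conj.
by under eq_fun do rewrite Im_conj; exact: is_tderiveN.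
Qed.

Lemma is_ctderive_sum n (F : 'I_n -> R -> R[i]) t (L : 'I_n -> R[i]) :
  (forall k, is_ctderive a b (F k) t (L k)) ->
  is_ctderive a b (fun s => \sum_k F k s) t (\sum_k L k).
Proof.
elim: n F L => [|n IH] F L dF.
  rewrite big_ord0; under eq_fun do rewrite big_ord0; exact: is_ctderive_cst.
rewrite big_ord_recl; under eq_fun do rewrite big_ord_recl.
by apply: is_ctderiveD => //; apply: IH => k.
Qed.

Implicit Types (u w : R -> 'rV[R[i]]_3) (v p : 'rV[R[i]]_3).

Lemma is_vtderiveD u w t v v' : is_vtderive a b u t v ->
  is_vtderive a b w t v' -> is_vtderive a b (fun s => u s + w s) t (v + v').
Proof.
move=> du dw k; rewrite mxE; under eq_fun do rewrite mxE.
by apply: is_ctderiveD; [exact: du|exact: dw].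
Qed.

Lemma is_vtderiveZ c u t v : is_vtderive a b u t v ->
  is_vtderive a b (fun s => c *: u s) t (c *: v).
Proof.
move=> du k; rewrite mxE; under eq_fun do rewrite mxE.
by apply: is_ctderiveZ; exact: du.
Qed.

Lemma is_vtderive_crossp u t v p : is_vtderive a b u t v ->
  is_vtderive a b (fun s => crossp (u s) p) t (crossp v p).
Proof.
move=> du k; rewrite mxE; under eq_fun do rewrite mxE.
have H (i j : 'I_3) :
    is_ctderive a b (fun s => u s 0 i * p 0 j) t (v 0 i * p 0 j).
  by under eq_fun do rewrite mulrC; rewrite mulrC; apply: is_ctderiveZ; exact: du.
apply: is_ctderiveD => //; rewrite -mulN1r; under eq_fun do rewrite -mulN1r.
exact: is_ctderiveZ.
Qed.

Lemma is_ctderive_dotp u t v p : is_vtderive a b u t v ->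
  is_ctderive a b (fun s => dotp p (u s)) t (dotp p v).
Proof.
by move=> du; apply: is_ctderive_sum => k; apply: is_ctderiveZ; exact: du.
Qed.

End ComplexTimeDerivative.

(** * Commutation of time and phase-space derivatives *)

Section MixedDerivatives.
Context {R : realType} (a b : R).

(** The time derivative of ['D_v (f s) z] and the number ['D_v f' z] are the two mixed derivatives
    of the extension [g] at [(t, z)], equal by [derive_comm]. *)
Lemma is_tderive_derive {V : normedModType R} (g : (R^o * V)%type -> R^o)
    (f : R -> V -> R^o) (f' : V -> R^o) t (v z : V) :
  a < b -> t \in `[a, b] -> Cn 2 g ->
  (forall s y, s \in `[a, b] -> f s y = g (s, y)) ->
  (forall y, is_tderive a b (f^~ y) t (f' y)) ->
  derivable f' z v /\ is_tderive a b (fun s => 'D_v (f s) z) t ('D_v f' z).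
Proof.
move=> ab tab C2 fg df; have [_ C1] := C2.
have d1 w y : derivable g y w by case: (C1 w).
have d2 w w' y : derivable ('D_w g) y w'.
  by case: (C1 w) => _ [_ /(_ w')[]].
pose e : (R^o * V)%type := (1, 0).
(* Uniqueness of the time derivative lets the extension determine [f'], even when [t] is an end
   point. *)
have -> : f' = fun y => 'D_e g (t, y).
  apply/funext => y; apply: (is_tderive_unique ab tab (df y)).
  apply: (is_tderive_eq tab _
    (is_derive_is_tderive a b (is_derive_time_slice (d1 e (t, y))))) => s sab.
  by rewrite fg.
split; first by have := d2 e (0, v) (t, z); rewrite -derivable_slice.
rewrite (derive_slice ('D_e g)) derive_comm //.
apply: (is_tderive_eq tab _
  (is_derive_is_tderive a b (is_derive_time_slice (d2 (0, v) e (t, z))))) => s sab.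
rewrite -derive_slice.
by congr ('D_v _ z); apply/funext => y; rewrite fg.
Qed.

(** [pderive] is total, like ['D_v]; this records that its two limits exist, as the scaling rules
    require. *)
Definition cderivable (f : phase R -> R[i]) (z v : phase R) : Prop :=
  derivable (fun y => complex.Re (f y) : R^o) z v /\
  derivable (fun y => complex.Im (f y) : R^o) z v.

Lemma is_ctderive_pderive (chi : R -> phase R -> R[i])
    (dchi : phase R -> R[i]) t v z :
  a < b -> t \in `[a, b] ->
  csmooth_on [set x : (R^o * phase R)%type | x.1 \in `[a, b]]
    (fun x => chi x.1 x.2) ->
  (forall y, is_ctderive a b (chi^~ y) t (dchi y)) ->
  cderivable dchi z v /\
  is_ctderive a b (fun s => pderive v (chi s) z) t (pderive v dchi z).
Proof.
move=> ab tab [g [[gR gI] chig]] dchi_.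
have chigE s y : s \in `[a, b] -> chi s y = g (s, y).
  by move=> sab; rewrite -(chig (s, y)).
have [dR tR] := @is_tderive_derive _ (fun x => complex.Re (g x) : R^o)
  (fun s y => complex.Re (chi s y)) (fun y => complex.Re (dchi y)) t v z
  ab tab (gR 2) (fun s y sab => congr1 (@complex.Re R) (chigE s y sab))
  (fun y => proj1 (dchi_ y)).
have [dI tI] := @is_tderive_derive _ (fun x => complex.Im (g x) : R^o)
  (fun s y => complex.Im (chi s y)) (fun y => complex.Im (dchi y)) t v z
  ab tab (gI 2) (fun s y sab => congr1 (@complex.Im R) (chigE s y sab))
  (fun y => proj2 (dchi_ y)).
by split; split; [exact: dR|exact: dI|exact: tR|exact: tI].
Qed.

(** A complex scalar mixes the real and imaginary parts, so the rule follows from real linearity of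
    ['D_v] on both. *)
Lemma pderiveZ (c : R[i]) (f : phase R -> R[i]) z v : cderivable f z v ->
  pderive v (fun y => c * f y) z = c * pderive v f z.
Proof.
move=> [dR dI]; case: c => p q; rewrite /pderive.
pose fR y : R^o := complex.Re (f y); pose fI y : R^o := complex.Im (f y).
have -> : (fun y => complex.Re ((p +i* q)%C * f y) : R^o) = p \*: fR - q \*: fI.
  by apply/funext => y; rewrite Re_mul.
have -> : (fun y => complex.Im ((p +i* q)%C * f y) : R^o) = p \*: fI + q \*: fR.
  by apply/funext => y; rewrite Im_mul.
have ZR k : derivable (k \*: fR) z v := derivableZ dR.
have ZI k : derivable (k \*: fI) z v := derivableZ dI.
by rewrite (deriveB (ZR p) (ZI q)) (deriveD (ZI p) (ZR q)) !(deriveZ _ dR)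
  !(deriveZ _ dI).
Qed.

End MixedDerivatives.

(** * Integrals of complex functions over phase space *)

Section ComplexIntegrals.
Context {R : realType}.
Implicit Types (f g : phase R -> R[i]).

Lemma integrable6B (f g : phase R -> R) : integrable6 f -> integrable6 g ->
  integrable6 (fun z => f z - g z).
Proof. by move=> fi gi; apply: (integrableB _ fi gi). Qed.

Lemma integrable6Zl (c : R) (f : phase R -> R) : integrable6 f ->
  integrable6 (fun z => c * f z).
Proof. by move=> fi; apply: (integrableZl _ c fi). Qed.

Lemma integral6B (f g : phase R -> R) : integrable6 f -> integrable6 g ->
  integral6 (fun z => f z - g z) = integral6 f - integral6 g.
Proof. by move=> fi gi; exact: RintegralB. Qed.

Lemma integral6D (f g : phase R -> R) : integrable6 f -> integrable6 g ->
  integral6 (fun z => f z + g z) = integral6 f + integral6 g.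
Proof. by move=> fi gi; exact: RintegralD. Qed.

Lemma integral6Zl (c : R) (f : phase R -> R) : integrable6 f ->
  integral6 (fun z => c * f z) = c * integral6 f.
Proof. by move=> fi; exact: RintegralZl. Qed.

Lemma integral6N (f : phase R -> R) : integrable6 f ->
  integral6 (fun z => - f z) = - integral6 f.
Proof.
by move=> fi; rewrite -mulN1r -integral6Zl //; under eq_fun do rewrite -mulN1r.
Qed.

Lemma integrable6N (f : phase R -> R) : integrable6 f ->
  integrable6 (fun z => - f z).
Proof. by under [fun z => - _]eq_fun do rewrite -mulN1r; exact: integrable6Zl. Qed.

Lemma cintegrable6_conj f : cintegrable6 f -> cintegrable6 (fun z => conjc (f z)).
Proof.
move=> [fR fI]; split.
  by under eq_fun do rewrite Re_conj.
by under eq_fun do rewrite Im_conj; exact: integrable6N.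
Qed.

Lemma cintegral6_conj f : cintegrable6 f ->
  cintegral6 (fun z => conjc (f z)) = conjc (cintegral6 f).
Proof.
move=> [fR fI]; rewrite /cintegral6.
under [X in (integral6 X +i* _)%C]eq_fun do rewrite Re_conj.
by under [X in (_ +i* integral6 X)%C]eq_fun do rewrite Im_conj; rewrite integral6N.
Qed.

Lemma cintegrable6B f g : cintegrable6 f -> cintegrable6 g ->
  cintegrable6 (fun z => f z - g z).
Proof.
move=> [fR fI] [gR gI]; split.
  by under eq_fun do rewrite raddfB; exact: integrable6B.
by under eq_fun do rewrite raddfB; exact: integrable6B.
Qed.

Lemma cintegral6B f g : cintegrable6 f -> cintegrable6 g ->
  cintegral6 (fun z => f z - g z) = cintegral6 f - cintegral6 g.
Proof.
move=> [fR fI] [gR gI]; rewrite /cintegral6.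
under [X in (integral6 X +i* _)%C]eq_fun do rewrite raddfB.
under [X in (_ +i* integral6 X)%C]eq_fun do rewrite raddfB.
by rewrite !integral6B.
Qed.

Lemma cintegral6Zl (c : R[i]) f : cintegrable6 f ->
  cintegral6 (fun z => c * f z) = c * cintegral6 f.
Proof.
move=> [fR fI]; case: c => p q; rewrite /cintegral6.
under [X in (integral6 X +i* _)%C]eq_fun do rewrite Re_mul.
under [X in (_ +i* integral6 X)%C]eq_fun do rewrite Im_mul.
rewrite integral6B ?integral6D ?integral6Zl //; exact: integrable6Zl.
Qed.

Lemma normc_ge_Im (x : R[i]) : (`|complex.Im x|%:C)%C <= `|x|.
Proof.
by rewrite normc_def lecR -sqrtr_sqr ler_wsqrtr // lerDr sqr_ge0.
Qed.

(** The real case applies to each part with the same [g], since a bound on the modulus of the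
    derivative bounds both parts. *)
Lemma is_ctderive_cintegral6 (a b : R) (phi : R -> phase R -> R[i])
    (phi' : phase R -> R[i]) (g : phase R -> R) t :
  t \in `[a, b] ->
  (forall s, s \in `[a, b] -> cintegrable6 (phi s)) ->
  integrable6 g ->
  (forall s z, s \in `[a, b] ->
    exists2 l, is_ctderive a b (phi^~ z) s l & `|l| <= (g z)%:C%C) ->
  (forall z, is_ctderive a b (phi^~ z) t (phi' z)) ->
  is_ctderive a b (fun s => cintegral6 (phi s)) t (cintegral6 phi').
Proof.
(* Unqualified, [point] is the default element of a pointed type. *)
move=> tab phi_i gi dom dphi; split; rewrite /cintegral6 /= /integral6.
  apply: (@is_tderive_Rintegral _ _ _ (leb6 R) a b
    (fun s w => complex.Re (phi s (Defs.point w)))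
    (fun w => complex.Re (phi' (Defs.point w)))
    (fun w => g (Defs.point w)) t tab _ gi).
  - by move=> s sab; case: (phi_i s sab).
  - move=> s w sab; have [l [lR _] lg] := dom s (Defs.point w) sab.
    exists (complex.Re l); first exact: lR.
    by rewrite -lecR; apply: le_trans (normc_ge_Re _) lg.
  - by move=> w; case: (dphi (Defs.point w)).
apply: (@is_tderive_Rintegral _ _ _ (leb6 R) a b
  (fun s w => complex.Im (phi s (Defs.point w)))
  (fun w => complex.Im (phi' (Defs.point w)))
    (fun w => g (Defs.point w)) t tab _ gi).
- by move=> s sab; case: (phi_i s sab).
- move=> s w sab; have [l [_ lI] lg] := dom s (Defs.point w) sab.
  exists (complex.Im l); first exact: lI.
  by rewrite -lecR; apply: le_trans (normc_ge_Im _) lg.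
- by move=> w; case: (dphi (Defs.point w)).
Qed.

End ComplexIntegrals.

(** * Linearity and time derivative of the angular momentum *)

Section AngularMomentum.
Context {R : realType} (hbar a b : R) (chi : R -> phase R -> R[i]).
Context (hbar_gt0 : 0 < hbar) (a_lt_b : a < b).
Context (chi_smooth : csmooth_on
  [set x : (R^o * phase R)%type | x.1 \in `[a, b]] (fun x => chi x.1 x.2)).

Lemma hbarC_neq0 : (hbar%:C)%C != 0 :> R[i].
Proof. by rewrite eq_complex /= eqxx andbT gt_eqF. Qed.

Lemma ihbar_neq0 : ihbar hbar != 0 :> R[i].
Proof. by rewrite mulf_neq0 ?hbarC_neq0 // neq0Ci. Qed.

Lemma ihbarV : - ('i%C / hbar%:C%C) = (ihbar hbar)^-1 :> R[i].
Proof.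
apply: (mulIf ihbar_neq0); rewrite mulVf ?ihbar_neq0 // /ihbar.
rewrite mulNr mulrCA divfK ?hbarC_neq0 //.
by rewrite -expr2 sqr_i opprK.
Qed.

(** [ihbar hbar] is purely imaginary. This sign turns the sum of the product rule into a difference
    of conjugate terms in the derivative of the average. *)
Lemma conj_ihbarV : conjc (ihbar hbar)^-1 = - (ihbar hbar)^-1 :> R[i].
Proof.
rewrite fmorphV -invrN; congr _^-1.
apply/eqP; rewrite eq_complex Re_conj Im_conj !raddfN /ihbar !Re_mul !Im_mul /=.
by rewrite !(mul0r, mulr0, oppr0, addr0) !eqxx.
Qed.

Lemma crosspZl (c : R[i]) (u v : 'rV[R[i]]_3) :
  crossp (c *: u) v = c *: crossp u v.
Proof. by apply/rowP => k; rewrite !mxE mulrBr !mulrA. Qed.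

Lemma dotpZr (c : R[i]) (u v : 'rV[R[i]]_3) : dotp u (c *: v) = c * dotp u v.
Proof. by rewrite mulr_sumr; apply: eq_bigr => k _; rewrite mxE mulrCA. Qed.

Lemma gradqZ (c : R[i]) (f : phase R -> R[i]) z :
  (forall v, cderivable f z v) -> gradq (fun y => c * f y) z = c *: gradq f z.
Proof. by move=> df; apply/rowP => k; rewrite !mxE pderiveZ. Qed.

Lemma gradpZ (c : R[i]) (f : phase R -> R[i]) z :
  (forall v, cderivable f z v) -> gradp (fun y => c * f y) z = c *: gradp f z.
Proof. by move=> df; apply/rowP => k; rewrite !mxE pderiveZ. Qed.

Lemma ang_momZ (c : R[i]) (f : phase R -> R[i]) z :
  (forall v, cderivable f z v) ->
  ang_mom hbar (fun y => c * f y) z = c *: ang_mom hbar f z.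
Proof.
move=> df; rewrite /ang_mom (gradpZ c df) (gradqZ c df).
move: (gradp f z) (gradq f z) => u v; rewrite !crosspZl -scalerDr.
by rewrite scalerA [in RHS]scalerA mulrC.
Qed.

(** At fixed [z] only the gradients depend on time; [is_ctderive_pderive] differentiates them entry
    by entry. *)
Lemma is_vtderive_ang_mom (dchi : phase R -> R[i]) t z : t \in `[a, b] ->
  (forall y, is_ctderive a b (chi^~ y) t (dchi y)) ->
  is_vtderive a b (fun s => ang_mom hbar (chi s) z) t (ang_mom hbar dchi z).
Proof.
move=> tab dchi_; apply: is_vtderiveZ; apply: is_vtderiveD.
  apply: is_vtderive_crossp => k; rewrite mxE; under eq_fun do rewrite mxE.
  by have [] := is_ctderive_pderive (dirp R k) z a_lt_b tab chi_smooth dchi_.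
apply: is_vtderive_crossp => k; rewrite mxE; under eq_fun do rewrite mxE.
by have [] := is_ctderive_pderive (dirq R k) z a_lt_b tab chi_smooth dchi_.
Qed.

End AngularMomentum.

Theorem theorem4p2 (R : realType) (hbar a b : R) (H : phase R -> R)
    (chi : R -> phase R -> R[i])
    (hbar_gt0 : 0 < hbar) (a_lt_b : a < b) (H_smooth : smooth H)
    (chi_vH : vanHove_wave_function hbar a b chi)
    (chi_reg : regular_wave_function hbar a b H chi)
    (chi_sol : solves_vanHove hbar a b H chi) :
  (forall (t : R) (z : phase R), t \in `[a, b] ->
     let LH := liouvillian hbar H (chi t) in
     let D := crossp (gradq LH z) (toC3 z.1) + crossp (gradp LH z) (toC3 z.2) in
     is_vtderive a b (fun s => ang_mom hbar (chi s) z) t D /\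
     D = (- ('i%C / hbar%:C%C)) *: ang_mom hbar LH z) /\
  (forall (xi : 'rV[R]_3) (t : R), t \in `[a, b] ->
     is_ctderive a b (fun s => average (ang_mom_along hbar xi) (chi s)) t
       (2 / hbar * complex.Im (inner (ang_mom_along hbar xi (chi t))
                             (liouvillian hbar H (chi t))))%:C%C).
Proof.
pose c : R[i] := (ihbar hbar)^-1.
(* The evolution equation solved for the time derivative. *)
pose dchi t z : R[i] := c * liouvillian hbar H (chi t) z.
have ih0 : ihbar hbar != 0 := ihbar_neq0 hbar_gt0.
have cE : - ('i%C / hbar%:C%C) = c := ihbarV hbar_gt0.
have cJ : conjc c = - c := conj_ihbarV hbar.
have chi_smooth := reg_smooth chi_reg.
have dchiP t z : t \in `[a, b] -> is_ctderive a b (chi^~ z) t (dchi t z).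
  move=> tab; have [d dP dE] := chi_sol t z tab.
  by rewrite /dchi -dE /c mulKf.
have cd t z v : t \in `[a, b] -> cderivable (dchi t) z v.
  move=> tab.
  by have [] := is_ctderive_pderive v z a_lt_b tab chi_smooth (dchiP t ^~ tab).
(* In this form [liouvillian hbar H (chi t)] inherits differentiability from [dchi t], and the
   scalar can be pulled out of its gradients. *)
have LHE t : liouvillian hbar H (chi t) = fun y => ihbar hbar * dchi t y.
  by apply/funext => y; rewrite /dchi /c mulVKf.
have dang t z : t \in `[a, b] ->
    is_vtderive a b (fun s => ang_mom hbar (chi s) z) t
      (c *: ang_mom hbar (liouvillian hbar H (chi t)) z).
  move=> tab; rewrite LHE ang_momZ; last by move=> v; exact: cd.
  rewrite scalerA mulVf // scale1r.
  apply: (@is_vtderive_ang_mom R hbar a b chi a_lt_b chi_smooth (dchi t) t z tab).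
  by move=> y; exact: dchiP.
split=> [t z tab LH D|xi t tab].
  (* Both sides reduce to [ihbar hbar] times the same two cross products of gradients of [dchi t],
     in opposite order. *)
  have DE : D = (- ('i%C / hbar%:C%C)) *: ang_mom hbar LH z.
    rewrite /D /LH cE LHE ang_momZ; last by move=> v; exact: cd.
    rewrite scalerA mulVf // scale1r gradqZ; last by move=> v; exact: cd.
    rewrite gradpZ; last by move=> v; exact: cd.
    rewrite /ang_mom; move: (gradq (dchi t) z) (gradp (dchi t) z) => u v.
    by rewrite !crosspZl -scalerDr addrC.
  by split=> //; rewrite DE cE; exact: dang.
pose LH := liouvillian hbar H (chi t).
pose A := ang_mom_along hbar xi.
have dA s z : s \in `[a, b] -> is_ctderive a b (fun r => A (chi r) z) s
    (c * A (liouvillian hbar H (chi s)) z).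
  by move=> sab; rewrite -dotpZr; apply: is_ctderive_dotp; exact: dang.
have dphi s z (sab : s \in `[a, b]) :=
  is_ctderiveM (is_ctderive_conj (dchiP s z sab)) (dA s z sab).
(* The product rule, arranged so that the two terms integrate to [inner (chi t) (A LH)] and the
   conjugate of [inner (A (chi t)) LH]; the minus sign is [cJ]. *)
pose phi' z := c * (conjc (chi t z) * A LH z - conjc (conjc (A (chi t) z) * LH z)).
have dphi_t z :
    is_ctderive a b (fun s => conjc (chi s z) * A (chi s) z) t (phi' z).
  rewrite (_ : phi' z = conjc (dchi t z) * A (chi t) z +
    conjc (chi t z) * (c * A LH z)); first exact: dphi.
  have cM (x y : R[i]) : conjc (x * y) = conjc x * conjc y := rmorphM _ x y.
  rewrite /phi' /dchi !cM conjcK cJ -/LH.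
  move: (conjc (chi t z)) (conjc (LH z)) (A LH z) (A (chi t) z) => x y w v.
  ring.
have [g gi gdom] := reg_dominated chi_reg xi.
have phi_i s : s \in `[a, b] ->
    cintegrable6 (fun z => conjc (chi s z) * A (chi s) z).
  by move=> sab; have [[]] := reg_sym_ang_mom chi_reg xi sab.
have avg : is_ctderive a b (fun s => average A (chi s)) t (cintegral6 phi').
  apply: (@is_ctderive_cintegral6 R a b
    (fun s z => conjc (chi s z) * A (chi s) z) phi' g t tab phi_i gi _ dphi_t).
  (* The majorant bounds whatever number is the time derivative of the integrand, hence the value
     given by the product rule. *)
  move=> s z sab; exists (conjc (dchi s z) * A (chi s) z +
    conjc (chi s z) * (c * A (liouvillian hbar H (chi s)) z)).
    exact: dphi.
  exact: gdom s z _ sab (dphi s z sab).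
have [_ [i1 i2 symE]] := reg_sym_ang_mom chi_reg xi tab.
have <- // : cintegral6 phi' = (2 / hbar * complex.Im (inner (A (chi t)) LH))%:C%C.
rewrite /phi' cintegral6Zl; last first.
  by apply: cintegrable6B => //; exact: cintegrable6_conj.
rewrite cintegral6B //; last exact: cintegrable6_conj.
rewrite cintegral6_conj // -/(inner (chi t) (A LH)) -/(inner (A (chi t)) LH).
(* Symmetry leaves [c * (K - conjc K)] with [K = inner (A (chi t)) LH]. Here [K - conjc K] is
   [2 i Im K] and [c] is [- i / hbar], so [- i^2 = 1] leaves the real number [2 / hbar * Im K]. *)
rewrite /A /LH symE subcJ -cE.
rewrite -/LH -/A !rmorphM fmorphV rmorph_nat /=.
move: (integral6 _)%:C%C (hbar%:C%C)^-1 => x h.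
rewrite (_ : _ * _ = - 'i%C ^+ 2 * (2 * h * x)); last by ring.
by rewrite sqr_i opprK mul1r.
Qed.
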